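(* Let $\mathbb{F}$ be any field of characteristic different from $2$. With $$B=\begin{pmatrix}0&0&0&0\\ 0&0&0&0\\ 0&0&0&0\\ 1&1&0&0\end{pmatrix},\quad B'=\begin{pmatrix}0&0&0&0\\ 0&0&0&0\\ 0&0&0&0\\ 1&1&1&0\end{pmatrix},\quad C_a=\begin{pmatrix}0&0&0&0\\ 0&0&0&0\\ 1&1&0&0\\ a&0&1&0\end{pmatrix}\ (a\in\mathbb{F}),\quad D_u=\begin{pmatrix}0&0&0&0\\ 0&0&0&0\\ 1&1&0&0\\ u&1&0&0\end{pmatrix}\ (u\in\mathbb{F}^\times),$$ and $\overline{T}$ denoting the $\sim$-class of $T$, we have $$\overline{\mathcal{TM}_4}(0)=\{\overline{0_4}\},\qquad \overline{\mathcal{TM}_4}(4)=\{\overline{B},\overline{B'}\},$$ $$\overline{\mathcal{TM}_4}(3,4)=\{\overline{C_a}:a\in\mathbb{F}\},\qquad \overline{\mathcal{TM}_4}(3)=\{\overline{D_u}:u\in\mathbb{F}^\times\}.$$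
   Context: Let $\mathbb{F}$ be a field of characteristic different from $2$, and $\mathbb{F}^\times=\mathbb{F}\setminus\{0\}$. For $n\geq 2$, $\mathcal{TM}_n$ denotes the set of all strictly lower triangular $n\times n$ matrices with entries in $\mathbb{F}$, and $0_n$ the zero matrix. For $T=[t_{ij}]\in\mathcal{TM}_n$, $\mathcal{A}(T)$ is the commutative (unital, associative) $\mathbb{F}$-algebra given by generators $X_1,\dots,X_n$ and relations $X_1^2=0$ and $X_i^2=\sum_{j<i}t_{ij}X_jX_i$ for $2\leq i\leq n$; it is graded by $\deg(X_i)=2$. For $T,S\in\mathcal{TM}_n$ write $T\sim S$ if there is a degree preserving isomorphism of graded $\mathbb{F}$-algebras $\mathcal{A}(T)\to\mathcal{A}(S)$; $\overline{T}$ is the $\sim$-class of $T$. Leaders: for $T\in\mathcal{TM}_n$ let $c_r=\max\{j:t_{rj}\neq 0\}$ if the $r$-th row is nonzero and $c_r=0$ otherwise; if $c_r>0$, $(r,c_r)$ is the leader position of row $r$. For $i<j<k$ put $\Delta^{(2)}_{i,j,k}(T)=2t_{ki}+t_{kj}t_{ji}$. 1-REF: $S\in\mathcal{TM}_n$, $S\neq 0_n$, is in first reduced echelon form (1-REF) if (1) its zero rows are above its nonzero rows; (2) for each leader position $(r,c)$ we have $c>1$ and there is $1\leq i_0<c$ with $\Delta^{(2)}_{i_0,c,r}(S)\neq 0$; (3) $c_r\leq c_{r+1}$ whenever rows $r,r+1$ are both nonzero. The zero matrix is also in 1-REF. Wall: if $S\nsim 0_n$ is in 1-REF, put $r_1=\min\{r: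 \text{row } r \text{ of } S\text{ is nonzero}\}$ and, given $r_j$, let $A_j=\{r: r_j<r\leq n,\ c_r\geq r_j\}$; if $A_j\neq\emptyset$ put $r_{j+1}=\min A_j$, otherwise stop and set $\mathbb{W}(S)=(r_1,\dots,r_j)$. Set $\mathbb{W}(0_n)=(0)$. For arbitrary $T\in\mathcal{TM}_n$, $\mathbb{W}(T)=\mathbb{W}(S)$ for any $S$ in 1-REF with $T\sim S$ (it is known that such $S$ exists and that this is well defined). For a wall $\mathbb{W}$, $\mathcal{TM}_n(\mathbb{W})=\{T\in\mathcal{TM}_n:\mathbb{W}(T)=\mathbb{W}\}$ and $\overline{\mathcal{TM}_n}(\mathbb{W})=\{\overline{T}:T\in\mathcal{TM}_n(\mathbb{W})\}$; one writes $\overline{\mathcal{TM}_4}(3,4)$ for $\overline{\mathcal{TM}_4}((3,4))$, etc. *)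

(* Defs.v *)
From HB Require Import structures.
From mathcomp Require Import all_boot all_algebra ring_quotient.
From mathcomp Require Import mpoly.
From mathcomp Require Import boolp classical_sets.
Set Implicit Arguments.
Unset Strict Implicit.
Unset Printing Implicit Defensive.

Import GRing.Theory.
Local Open Scope ring_scope.
Local Open Scope quotient_scope.

(* Rows and columns of a matrix are indexed from 0 by 'I_n, while leader
   columns and walls are natural numbers counted from 1: the ordinal i stands
   for the index i.+1 of the mathematics. *)

Section Algebra.
Variables (F : fieldType) (n : nat).
Implicit Types T : 'M[F]_n.

Definition strict_lower T := forall i j : 'I_n, (i <= j)%N -> T i j = 0.

Definition defrel T (i : 'I_n) : {mpoly F[n]} :=
  'X_i ^+ 2 - \sum_(j < n | (j < i)%N) T i j *: ('X_j * 'X_i).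

Definition relideal T : {mpoly F[n]} -> bool := fun p =>
  `[< exists q : 'I_n -> {mpoly F[n]}, p = \sum_i q i * defrel T i >].

Lemma meval0_defrel T i : (defrel T i).@[fun _ => 0] = 0.
Proof.
rewrite mevalB expr2 mevalM mevalXU mulr0 sub0r [X in - X]raddf_sum.
rewrite big1 ?oppr0 // => j _.
by rewrite [LHS]mevalZ mevalM !mevalXU !mulr0.
Qed.

Lemma relideal_closed T : idealr_closed (relideal T).
Proof.
split=> [||a u v].
- apply/asboolP; exists (fun _ => 0).
  by rewrite big1 // => i _; rewrite mul0r.
- apply/asboolPn => -[q] /(congr1 (meval (fun _ => 0))).
  rewrite meval1 raddf_sum big1 => [/eqP|i _]; first by rewrite oner_eq0.
  by rewrite [LHS]mevalM meval0_defrel mulr0.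
- move=> /asboolP[q ->] /asboolP[r ->]; apply/asboolP.
  exists (fun i => a * q i + r i); rewrite mulr_sumr -big_split /=.
  by apply: eq_bigr => i _; rewrite mulrDl mulrA.
Qed.

HB.instance Definition _ T :=
  isIdealr.Build {mpoly F[n]} (relideal T) (relideal_closed T).

(* The algebra A(T) = F[X_1, ..., X_n] / (X_i^2 - \sum_(j < i) t_ij X_j X_i). *)
Definition algA T : Type := {ideal_quot (relideal T : idealr {mpoly F[n]})}.

HB.instance Definition _ T := GRing.ComNzRing.on (algA T).

Definition algA_pi T (p : {mpoly F[n]}) : algA T :=
  \pi_({ideal_quot (relideal T : idealr {mpoly F[n]})}) p.

Definition algA_scale T (c : F) (x : algA T) : algA T :=
  algA_pi T c%:MP * x.

Lemma algA_piD T : {morph algA_pi T : p q / p + q}.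
Proof. exact: rmorphD. Qed.

Lemma algA_piM T : {morph algA_pi T : p q / p * q}.
Proof. exact: rmorphM. Qed.

Lemma algA_pi1 T : algA_pi T 1 = 1.
Proof. exact: rmorph1. Qed.

Fact algA_scaleA T a b (x : algA T) :
  algA_scale a (algA_scale b x) = algA_scale (a * b) x.
Proof. by rewrite /algA_scale mulrA -algA_piM mpolyCM. Qed.

Fact algA_scale1 T : left_id 1 (@algA_scale T).
Proof. by move=> x; rewrite /algA_scale mpolyC1 algA_pi1 mul1r. Qed.

Fact algA_scaleDr T : right_distributive (@algA_scale T) +%R.
Proof. by move=> c x y; rewrite /algA_scale mulrDr. Qed.

Fact algA_scaleDl T (x : algA T) :
  {morph (@algA_scale T)^~ x : a b / a + b}.
Proof. by move=> a b; rewrite /algA_scale mpolyCD algA_piD mulrDl. Qed.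

HB.instance Definition _ T := GRing.Zmodule_isLmodule.Build F (algA T)
  (@algA_scaleA T) (@algA_scale1 T) (@algA_scaleDr T) (@algA_scaleDl T).

Fact algA_scaleAl T (c : F) (x y : algA T) : c *: (x * y) = c *: x * y.
Proof. by rewrite /GRing.scale /= /algA_scale mulrA. Qed.

HB.instance Definition _ T :=
  GRing.Lmodule_isLalgebra.Build F (algA T) (@algA_scaleAl T).

Fact algA_scaleAr T (c : F) (x y : algA T) : c *: (x * y) = x * (c *: y).
Proof. by rewrite /GRing.scale /= /algA_scale mulrCA. Qed.

HB.instance Definition _ T :=
  GRing.Lalgebra_isAlgebra.Build F (algA T) (@algA_scaleAr T).

(* Degree d component of A(T), every generator X_i having degree 2. *)
Definition algA_deg T (d : nat) : set (algA T) :=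
  [set algA_pi T p | p in
    [set p : {mpoly F[n]} | forall m, m \in msupp p -> (2 * mdeg m)%N = d]]%classic.

Arguments algA_deg : clear implicits.

Definition sim T S : Prop :=
  exists f : {lrmorphism algA T -> algA S},
    bijective f /\ forall d x, algA_deg T d x -> algA_deg S d (f x).

Definition simclass T : set 'M[F]_n :=
  [set S | strict_lower S /\ sim T S]%classic.

End Algebra.

Section Walls.
Variables (F : fieldType) (n : nat).
Implicit Types T S : 'M[F]_n.

Definition lead T (r : 'I_n) : nat := \max_(j < n | T r j != 0) j.+1.

Definition Delta2 T (i j k : 'I_n) : F := 2%:R * T k i + T k j * T j i.

Definition one_ref S : Prop :=
  strict_lower S /\
  (S = 0 \/
   [/\ forall r r' : 'I_n, row r S = 0 -> row r' S != 0 -> (r < r')%N,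
       forall r c : 'I_n, lead S r = c.+1 ->
         (1 < c.+1)%N /\ exists i0 : 'I_n, (i0 < c)%N /\ Delta2 S i0 c r != 0
     & forall r r' : 'I_n, r' = r.+1 :> nat ->
         row r S != 0 -> row r' S != 0 -> (lead S r <= lead S r')%N]).

(* Indices r' > r with c_r' >= r (r is r.+1 when counted from 1), listed in
   increasing order. *)
Definition wall_next S (r : 'I_n) : seq 'I_n :=
  [seq r' : 'I_n <- enum 'I_n | (r < r')%N && (r.+1 <= lead S r')%N].

(* The wall is strictly increasing, so n steps of fuel always suffice. *)
Fixpoint wall_from (fuel : nat) S (r : 'I_n) : seq 'I_n :=
  r :: match fuel, wall_next S r with
       | k.+1, r' :: _ => wall_from k S r'
       | _, _ => [::]
       end.

Definition wall_ref S : seq nat :=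
  if `[< sim S 0 >] then [:: 0%N]
  else match [seq r : 'I_n <- enum 'I_n | row r S != 0] with
       | r :: _ => [seq (i : 'I_n).+1 | i <- wall_from n S r]
       | [::] => [::]
       end.

(* The wall of an arbitrary T is read off an arbitrary 1-REF representative of
   its class; the default value of xget is irrelevant, as one always exists. *)
Definition wall T : seq nat :=
  wall_ref (xget 0 [set S | one_ref S /\ sim T S]%classic).

Definition TM (W : seq nat) : set 'M[F]_n :=
  [set T | strict_lower T /\ wall T = W]%classic.

Definition TMbar (W : seq nat) : set (set 'M[F]_n) :=
  [set simclass T | T in TM W]%classic.

End Walls.

Arguments TM F n W : clear implicits.
Arguments TMbar F n W : clear implicits.

Section Matrices.
Variable F : fieldType.

Definition mx4 (rows : seq (seq F)) : 'M[F]_4 :=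
  \matrix_(i < 4, j < 4) (nth [::] rows i)`_j.

Definition matB : 'M[F]_4 :=
  mx4 [:: [:: 0; 0; 0; 0];
          [:: 0; 0; 0; 0];
          [:: 0; 0; 0; 0];
          [:: 1; 1; 0; 0]].

Definition matB' : 'M[F]_4 :=
  mx4 [:: [:: 0; 0; 0; 0];
          [:: 0; 0; 0; 0];
          [:: 0; 0; 0; 0];
          [:: 1; 1; 1; 0]].

Definition matC (a : F) : 'M[F]_4 :=
  mx4 [:: [:: 0; 0; 0; 0];
          [:: 0; 0; 0; 0];
          [:: 1; 1; 0; 0];
          [:: a; 0; 1; 0]].

Definition matD (u : F) : 'M[F]_4 :=
  mx4 [:: [:: 0; 0; 0; 0];
          [:: 0; 0; 0; 0];
          [:: 1; 1; 0; 0];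
          [:: u; 1; 0; 0]].

End Matrices.

Arguments matB {F}.
Arguments matB' {F}.

(* Main.v *)
Require Import Defs.
From HB Require Import structures.
From mathcomp Require Import all_boot all_algebra ring_quotient.
From mathcomp Require Import mpoly.
From mathcomp Require Import boolp classical_sets.
From mathcomp Require Import ring.
Import GRing.Theory.
Local Open Scope ring_scope.
Local Open Scope classical_set_scope.

(** An isomorphism A(T) -> A(S) is a linear substitution of the generators under
which every relation X_k (X_k - sum_l T k l X_l) vanishes in A(S); since the
products X_i X_j with i < j are linearly independent in A(S), this is a finite
list of polynomial identities.

In characteristic different from 2, completing the square in X_i ^ 2 = l_i X_i
gives Y_i = X_i - l_i / 2 with Y_i ^ 2 = l_i ^ 2 / 4, so only the elements l_i ^ 2
matter.  For n = 4 this reduces every T to 0, B, B', some C_a or some D_u.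

The walls are separated by the degree 2 elements of square zero: they span the generators
for 0, a space of dimension 3 for B and B', and of dimension 2 for C_a and D_u.
In D_u the elements with square in the line of X_1 X_2 still span everything,
whereas in C_a they have no X_4 component. *)

Set Implicit Arguments.
Unset Strict Implicit.
Unset Printing Implicit Defensive.

(** * Isomorphisms as linear substitutions *)

Section Presentation.
Variables (F : fieldType) (n : nat).
Implicit Types (i j k : 'I_n) (T S : 'M[F]_n) (u v : 'rV[F]_n) (p q : {mpoly F[n]}).

Lemma algA_pi_zmod_morphism T : zmod_morphism (@algA_pi F n T).
Proof. by move=> p q; exact: rmorphB. Qed.

Lemma algA_pi_monoid_morphism T : monoid_morphism (@algA_pi F n T).
Proof. by split=> [|p q]; [exact: algA_pi1 | exact: algA_piM]. Qed.

Lemma algA_pi_scalable T : scalable (@algA_pi F n T).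
Proof. by move=> c p; rewrite -mul_mpolyC algA_piM. Qed.

HB.instance Definition _ T :=
  GRing.isZmodMorphism.Build _ _ (@algA_pi F n T) (@algA_pi_zmod_morphism T).
HB.instance Definition _ T :=
  GRing.isMonoidMorphism.Build _ _ (@algA_pi F n T) (@algA_pi_monoid_morphism T).
HB.instance Definition _ T :=
  GRing.isScalable.Build F _ _ _ (@algA_pi F n T) (@algA_pi_scalable T).

Definition algA_repr T (x : algA T) : {mpoly F[n]} :=
  repr (x : {ideal_quot (relideal T : idealr {mpoly F[n]})}).

Lemma algA_reprK T (x : algA T) : algA_pi T (algA_repr x) = x.
Proof. by rewrite /algA_pi /algA_repr; exact: reprK. Qed.

Lemma algA_pi_eq0P T p :
  algA_pi T p = 0 <-> exists q : 'I_n -> {mpoly F[n]}, p = \sum_i q i * defrel T i.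
Proof.
have -> : (algA_pi T p = 0) <-> relideal T p.
  split.
    rewrite -(raddf0 (algA_pi T)) => /eqP.
    by rewrite -(@Quotient.idealrBE _ (relideal T : idealr _)) subr0.
  move=> Tp; apply/eqP; rewrite -(raddf0 (algA_pi T)).
  by rewrite -(@Quotient.idealrBE _ (relideal T : idealr _)) subr0.
by split=> /asboolP.
Qed.

Definition lform u : {mpoly F[n]} := \sum_j u 0 j *: 'X_j.

Lemma lform_is_linear : linear lform.
Proof.
move=> c u v; rewrite /lform scaler_sumr -big_split; apply: eq_bigr => j _.
by rewrite /= !mxE scalerA -scalerDl.
Qed.

HB.instance Definition _ :=
  GRing.isLinear.Build F _ _ _ lform lform_is_linear.

Lemma lform_delta i : lform (delta_mx 0 i) = 'X_i.
Proof.
rewrite /lform (bigD1 i) //= mxE !eqxx scale1r big1 ?addr0 // => j /negPf ji.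
by rewrite mxE ji andbF scale0r.
Qed.

(** Strict lower triangularity lets the sum over [j < k] run over the whole row, so each relation is
    a product of two linear forms. *)
Lemma defrelE T k : strict_lower T ->
  defrel T k = 'X_k * lform (delta_mx 0 k - row k T).
Proof.
move=> lT; rewrite linearB /= lform_delta mulrBr -expr2; congr (_ - _).
rewrite mulr_sumr [RHS](bigID (fun j : 'I_n => (j < k)%N)) /=.
rewrite [X in _ = _ + X]big1 => [|j].
  by rewrite addr0; apply: eq_bigr => j _; rewrite mxE -scalerAr mulrC.
by rewrite -leqNgt => /lT kj; rewrite mxE kj scale0r mulr0.
Qed.

Definition algA_vec T u : algA T := algA_pi T (lform u).

HB.instance Definition _ T := GRing.Linear.copy (algA_vec T) (algA_pi T \o lform).

Definition gen T i : algA T := algA_pi T 'X_i.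

Lemma algA_vecE T u : algA_vec T u = \sum_j u 0 j *: gen T j.
Proof.
by rewrite [LHS]raddf_sum; apply: eq_bigr => j _; exact: linearZ.
Qed.

Lemma algA_vec_delta T i : algA_vec T (delta_mx 0 i) = gen T i.
Proof. by rewrite /algA_vec lform_delta. Qed.

Lemma algA_pi_defrel T k : algA_pi T (defrel T k) = 0.
Proof.
apply/algA_pi_eq0P; exists (fun j => (j == k)%:R).
rewrite (bigD1 k) //= eqxx mul1r big1 ?addr0 // => j /negPf ->.
by rewrite mul0r.
Qed.

Lemma gen_sqr T i :
  gen T i ^+ 2 = \sum_(j < n | (j < i)%N) T i j *: (gen T j * gen T i).
Proof.
have := algA_pi_defrel T i.
rewrite /defrel rmorphB rmorphXn raddf_sum /= => /subr0_eq ->.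
by apply: eq_bigr => j _; rewrite [LHS]linearZ /= rmorphM.
Qed.

(* Modulo the ideal, linear and quadratic coefficients are read off from first
   and second derivatives at 0. *)
Definition grad i p : F := (p^`M(i)).@[fun _ => 0].
Definition hess i j p : F := grad j (p^`M(i)).

Lemma grad_is_linear i : linear_for *%R (grad i).
Proof. by move=> c p q; rewrite /grad linearP /= [LHS]mevalD [X in X + _]mevalZ. Qed.

HB.instance Definition _ i :=
  GRing.isLinear.Build F _ _ _ (grad i) (@grad_is_linear i).

Lemma hess_is_linear i j : linear_for *%R (hess i j).
Proof. by move=> c p q; rewrite /hess linearP /= linearP. Qed.

HB.instance Definition _ i j :=
  GRing.isLinear.Build F _ _ _ (hess i j) (@hess_is_linear i j).

Lemma mderiv_lform i u : (lform u)^`M(i) = (u 0 i)%:MP.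
Proof.
rewrite /lform raddf_sum (bigD1 i) //= linearZ /= mderivX mnmE eqxx /=.
rewrite scale1r -[X in (X - _)%MM]add0m addmK mpolyX0 -mul_mpolyC mulr1.
rewrite big1 ?addr0 // => j /negPf ji.
by rewrite /= linearZ /= mderivX mnmE ji scale0r scaler0.
Qed.

Lemma meval0_lform u : (lform u).@[fun _ => 0] = 0.
Proof.
rewrite [LHS]raddf_sum big1 // => j _.
by rewrite [LHS]mevalZ mevalXU mulr0.
Qed.

Lemma gradM i p q :
  grad i (p * q) = grad i p * q.@[fun _ => 0] + p.@[fun _ => 0] * grad i q.
Proof. by rewrite /grad mderivM mevalD !mevalM. Qed.

Lemma grad_lform i u : grad i (lform u) = u 0 i.
Proof. by rewrite /grad mderiv_lform mevalC. Qed.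

Lemma hess_lform i j u v :
  hess i j (lform u * lform v) = u 0 i * v 0 j + u 0 j * v 0 i.
Proof.
rewrite /hess mderivM !mderiv_lform raddfD /= !gradM !grad_lform !meval0_lform.
by rewrite !mevalC !(mulr0, mul0r, add0r, addr0) [u 0 j * _]mulrC; ring.
Qed.

Lemma grad_defrel T i k : grad k (defrel T i) = 0.
Proof.
have E j l : grad k ('X_j * 'X_l) = 0.
  by rewrite gradM !mevalXU mulr0 mul0r addr0.
rewrite /defrel expr2 linearB /= E (raddf_sum (grad k)) big1 ?subr0 // => j _.
by rewrite /= linearZ /= E mulr0.
Qed.

Lemma grad_algA_pi T i p q : algA_pi T p = algA_pi T q -> grad i p = grad i q.
Proof.
move=> /eqP; rewrite -subr_eq0 -raddfB => /eqP /algA_pi_eq0P[r E].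
apply/eqP; rewrite -subr_eq0 -raddfB E (raddf_sum (grad i)) big1 // => k _.
by rewrite /= gradM meval0_defrel grad_defrel !mulr0 addr0.
Qed.

(** A relation has neither constant nor linear term, so only the constant term of [p] reaches the
    second derivatives at 0. *)
Lemma hess_mul_defrel T i j k p :
  hess i j (p * defrel T k) = p.@[fun _ => 0] * hess i j (defrel T k).
Proof.
rewrite /hess mderivM raddfD /= !gradM meval0_defrel grad_defrel.
by rewrite -/(grad i (defrel T k)) grad_defrel !mulr0 !add0r.
Qed.

(* coef2 is twice the coefficient of X_i X_j (i < j) once every square X_j ^ 2
   has been replaced by \sum_(i < j) T j i X_i X_j. *)
Definition coef2 T i j p : F := 2%:R * hess i j p + T j i * hess j j p.

Lemma coef2_is_linear T i j : linear_for *%R (coef2 T i j).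
Proof. by move=> c p q; rewrite /coef2 !linearP /=; ring. Qed.

HB.instance Definition _ T i j :=
  GRing.isLinear.Build F _ _ _ (coef2 T i j) (@coef2_is_linear T i j).

(** For [i < j], this is the coefficient of [X_i X_j] in the product of the linear forms [u] and [v]
    once squares are eliminated. *)
Definition mulc T i j u v : F :=
  u 0 i * v 0 j + u 0 j * v 0 i + T j i * (u 0 j * v 0 j).

Lemma coef2_lform T i j u v :
  coef2 T i j (lform u * lform v) = 2%:R * mulc T i j u v.
Proof. by rewrite /coef2 !hess_lform /mulc; ring. Qed.

(** In the relation of [X_j] the terms [X_j ^ 2] and [- T j i X_i X_j] contribute [2 T j i] and
    [- 2 T j i]; in that of [X_i] the entry [T i j] is zero. *)
Lemma coef2_defrel T i j k : strict_lower T -> (i < j)%N ->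
  coef2 T i j (defrel T k) = 0.
Proof.
move=> lT ij; rewrite defrelE // -lform_delta coef2_lform /mulc !mxE !eqxx /=.
have ne : (i == j) = false by rewrite -(inj_eq val_inj) /= ltn_eqF.
case: (i =P k) => [<-|_].
  by rewrite [j == i]eq_sym ne lT ?(ltnW ij) // !(mulr0n, mul0r, mulr0, subr0, addr0).
case: (j =P k) => [<-|_]; last by rewrite !(mulr0n, mul0r, mulr0, addr0).
by rewrite lT // mulr1n mulr0n; ring.
Qed.

Lemma coef2_algA_pi0 T i j p : strict_lower T -> (i < j)%N ->
  algA_pi T p = 0 -> coef2 T i j p = 0.
Proof.
move=> lT ij /algA_pi_eq0P[q ->]; rewrite (raddf_sum (coef2 T i j)) big1 // => k _ /=.
rewrite /coef2 !hess_mul_defrel mulrCA [T j i * _]mulrCA -mulrDr.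
by rewrite -/(coef2 T i j (defrel T k)) coef2_defrel ?mulr0.
Qed.

Lemma algA_vecM T u v : algA_vec T u * algA_vec T v =
  \sum_(j < n) \sum_(i < n | (i < j)%N) mulc T i j u v *: (gen T i * gen T j).
Proof.
have sq j : gen T j * gen T j = \sum_(i < n | (i < j)%N) T j i *: (gen T i * gen T j).
  by rewrite -expr2 gen_sqr.
rewrite !algA_vecE mulr_suml.
under eq_bigr do rewrite mulr_sumr.
have E (i j : 'I_n) : (u 0 i *: gen T i) * (v 0 j *: gen T j)
    = (u 0 i * v 0 j) *: (gen T i * gen T j).
  by rewrite -scalerAl -scalerAr scalerA.
under eq_bigr do under eq_bigr do rewrite E.
(* The double sum is grouped by its larger index [j]: pairs below [j], transposed pairs, and the
   square, which [sq] expands. *)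
transitivity (\sum_(j < n) (
   \sum_(i < n | (i < j)%N) (u 0 i * v 0 j) *: (gen T i * gen T j) +
   (\sum_(i < n | (i < j)%N) (u 0 j * v 0 i) *: (gen T i * gen T j) +
    (u 0 j * v 0 j) *: (gen T j * gen T j)))).
  rewrite !big_split /=.
  rewrite [X in _ = X + _](exchange_big_dep predT) //= -!big_split /=.
  apply: eq_bigr => i _; rewrite (bigID (fun j : 'I_n => (i < j)%N)) /=; congr (_ + _).
  rewrite (bigD1 i) ?ltnn //= addrC; congr (_ + _).
  apply: eq_big => [j|j _]; last by rewrite [gen T i * _]mulrC.
  by rewrite -leqNgt [(j < i)%N]ltn_neqAle andbC.
apply: eq_bigr => j _; rewrite sq scaler_sumr -!big_split; apply: eq_bigr => i _.
rewrite /= scalerA -!scalerDl; congr (_ *: _); rewrite /mulc; ring.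
Qed.

Hypothesis two_neq0 : 2%:R != 0 :> F.

(** [coef2] reads off twice each coefficient, and the factor 2 can be cancelled. *)
Lemma algA_vecM_inj T c u v w z i j : strict_lower T -> (i < j)%N ->
  algA_vec T u * algA_vec T v = c *: (algA_vec T w * algA_vec T z) ->
  mulc T i j u v = c * mulc T i j w z.
Proof.
move=> lT ij /eqP; rewrite -subr_eq0 => /eqP E.
have /(coef2_algA_pi0 lT ij) :
    algA_pi T (lform u * lform v - c *: (lform w * lform z)) = 0.
  by rewrite -[RHS]E linearB linearZ /= !rmorphM.
rewrite linearB linearZ /= !coef2_lform => /eqP.
by rewrite mulrCA -mulrBr mulf_eq0 (negPf two_neq0) subr_eq0 => /eqP.
Qed.

Lemma algA_vecM_eq0 T u v : strict_lower T ->
  algA_vec T u * algA_vec T v = 0 <->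
  forall i j, (i < j)%N -> mulc T i j u v = 0.
Proof.
move=> lT; split=> [E i j ij | E].
  rewrite (@algA_vecM_inj T 0 u v u v) ?mul0r //.
  by rewrite E scale0r.
rewrite algA_vecM big1 // => j _; rewrite big1 // => i ij.
by rewrite E // scale0r.
Qed.

Lemma algA_vec_inj T : injective (algA_vec T).
Proof.
move=> u v E; apply/rowP=> i.
by rewrite -!grad_lform; apply: grad_algA_pi E.
Qed.

(* P carries T to S when the substitution X_k := row k of P sends every defining
   relation X_k (X_k - \sum_l T k l X_l) of A(T) to zero in A(S). *)
Definition carries T S (P : 'M[F]_n) := forall k i j, (i < j)%N ->
  mulc S i j (row k P) (row k (P - T *m P)) = 0.

(** * The morphism induced by a substitution *)

Section Substitution.
Variables (T S P : 'M[F]_n).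
Hypotheses (lT : strict_lower T) (lS : strict_lower S) (cP : carries T S P).

Let subst p := p \mPo [tuple lform (row k P) | k < n].

Lemma subst_lform u : subst (lform u) = lform (u *m P).
Proof.
rewrite /subst /lform raddf_sum /=.
under eq_bigr do rewrite comp_mpolyZ comp_mpolyXU -tnth_nth tnth_mktuple scaler_sumr.
rewrite exchange_big /=; apply: eq_bigr => j _; rewrite mxE scaler_suml.
by apply: eq_bigr => k _; rewrite mxE scalerA.
Qed.

Lemma subst_defrel k : algA_pi S (subst (defrel T k)) = 0.
Proof.
rewrite defrelE // -lform_delta [subst _]rmorphM /= rmorphM /=.
rewrite -!/(subst _) !subst_lform -!/(algA_vec S _).
rewrite mulmxBl -!rowE -row_mul -linearB /=.
by apply/algA_vecM_eq0; [exact: lS | exact: cP].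
Qed.

Let f (x : algA T) : algA S := algA_pi S (subst (algA_repr x)).

(** [f] goes through a chosen representative; two representatives differ by a combination of
    relations, whose images vanish, so the choice does not matter. *)
Lemma subst_pi p : f (algA_pi T p) = algA_pi S (subst p).
Proof.
rewrite /f; have := algA_reprK (algA_pi T p).
move=> /eqP; rewrite -subr_eq0 -raddfB => /eqP /algA_pi_eq0P[q E].
apply/eqP; rewrite -subr_eq0 -!raddfB /= E.
rewrite /subst (raddf_sum (comp_mpoly _)) (raddf_sum (algA_pi S)) big1 // => k _ /=.
by rewrite !rmorphM /= [X in _ * X](subst_defrel k) mulr0.
Qed.

Lemma subst_zmod_morphism : zmod_morphism f.
Proof.
move=> x y; rewrite -[x]algA_reprK -[y]algA_reprK -raddfB !subst_pi.
by rewrite /subst !raddfB.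
Qed.

Lemma subst_monoid_morphism : monoid_morphism f.
Proof.
split=> [|x y]; first by rewrite -(rmorph1 (algA_pi T)) subst_pi /subst !rmorph1.
rewrite -[x]algA_reprK -[y]algA_reprK -rmorphM !subst_pi.
by rewrite /subst !rmorphM.
Qed.

Lemma subst_scalable : scalable f.
Proof.
move=> c x; rewrite -[x]algA_reprK -linearZ !subst_pi.
by rewrite /subst !linearZ.
Qed.

HB.instance Definition _ :=
  GRing.isZmodMorphism.Build _ _ f subst_zmod_morphism.
HB.instance Definition _ :=
  GRing.isMonoidMorphism.Build _ _ f subst_monoid_morphism.
HB.instance Definition _ :=
  GRing.isScalable.Build F _ _ _ f subst_scalable.

Definition subst_morph : {lrmorphism algA T -> algA S} := f.

End Substitution.

Lemma subst_morph_vec T S P (lT : strict_lower T) (lS : strict_lower S)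
    (cP : carries T S P) u :
  subst_morph lT lS cP (algA_vec T u) = algA_vec S (u *m P).
Proof. by rewrite [LHS]subst_pi // subst_lform. Qed.

Lemma algA_morph_ext T (A : lalgType F) (f g : {lrmorphism algA T -> A}) :
  (forall i, f (gen T i) = g (gen T i)) -> f =1 g.
Proof.
move=> fg x; rewrite -[x]algA_reprK [algA_repr x]mpolyE !(raddf_sum (algA_pi T)).
rewrite !raddf_sum; apply: eq_bigr => m _ /=; rewrite !linearZ /=; congr (_ *: _).
rewrite mpolyXE_id !rmorph_prod; apply: eq_bigr => i _.
by rewrite !rmorphXn; congr (_ ^+ _); exact: fg.
Qed.

Lemma dhomog_comp_lform p (P : 'M[F]_n) d : p \is d.-homog ->
  p \mPo [tuple lform (row k P) | k < n] \is d.-homog.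
Proof.
move=> /dhomogP hp; rewrite comp_mpolyE big_seq; apply: rpred_sum => m /hp <-.
apply: rpredZ; rewrite /= mdegE; elim/big_rec2: _ => [|i q e _ he]; first exact: dhomog1.
apply: dhomogM => //; rewrite -[X in X.-homog]mul1n; apply: dhomogMn.
rewrite tnth_mktuple; apply: rpred_sum => j _.
by apply: rpredZ; rewrite dhomogX /= mdeg1.
Qed.

Lemma carries_sim T S P Q : strict_lower T -> strict_lower S ->
  P *m Q = 1%:M -> carries T S P -> carries S T Q -> sim T S.
Proof.
move=> lT lS PQ cP cQ; exists (subst_morph lT lS cP).
have QP := mulmx1C PQ.
(* Stated for arbitrary data because both composites have to be the identity; generators suffice. *)
have K T' S' P' Q' lT' lS' cP' cQ' : P' *m Q' = 1%:M ->
  cancel (@subst_morph T' S' P' lT' lS' cP') (@subst_morph S' T' Q' lS' lT' cQ').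
  move=> PQ' x.
  apply: (@algA_morph_ext _ _ (subst_morph lS' lT' cQ' \o subst_morph lT' lS' cP')
            idfun) => i.
  rewrite -algA_vec_delta; transitivity (algA_vec T' (delta_mx 0 i *m P' *m Q')).
    by rewrite -!(subst_morph_vec _ _ cQ') -(subst_morph_vec lT' lS' cP').
  by rewrite -mulmxA PQ' mulmx1.
split; first by exists (subst_morph lS lT cQ); exact: K.
move=> d x [p hp <-]; rewrite [subst_morph _ _ _ _]subst_pi //.
eexists; last by reflexivity.
move=> m; have [->|p0] := eqVneq p 0; first by rewrite raddf0 msupp0.
(* Generators have degree 2, so [p] is homogeneous of polynomial degree [d / 2], which the
   substitution by linear forms preserves. *)
have e : {e | forall m, m \in msupp p -> mdeg m = e & (2 * e)%N = d}.
  exists (mdeg (mlead p)); last exact: hp (mlead_supp p0).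
  move=> m' m'p; apply/eqP; rewrite -(eqn_pmul2l (ltn0Sn 1)).
  by rewrite (hp m' m'p) (hp _ (mlead_supp p0)).
case: e => e pe <-; have /dhomogP/dhomog_comp_lform/dhomogP h := pe.
by move/(h P) => /= ->.
Qed.

(** The image of a generator has degree 2, hence is represented by a linear form. The matrix of
    these forms is invertible because [f] is injective and the generators are linearly
    independent. *)
Lemma sim_vec T S : sim T S -> exists2 f : {lrmorphism algA T -> algA S}, injective f
  & exists2 P, P \in unitmx & forall u, f (algA_vec T u) = algA_vec S (u *m P).
Proof.
move=> [f [/bij_inj f_inj fdeg]]; exists f => //.
have /choice[P fP] i : exists u, f (gen T i) = algA_vec S u.
  have /fdeg[p hp <-] : @algA_deg F n T 2 (gen T i).
    by exists 'X_i => // m; rewrite msuppX inE => /eqP ->; rewrite mdeg1.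
  exists (\row_j p@_U_(j)); congr (algA_pi S _); apply/mpolyP => m.
  rewrite /lform raddf_sum /=.
  have [/mdeg1P[k /eqP ->]|m1] := boolP (mdeg m == 1%N).
    rewrite (bigD1 k) //= mcoeffZ mcoeffX eqxx mulr1 mxE big1 ?addr0 // => j jk.
    by rewrite mcoeffZ mcoeffX eq_mnm1 (negPf jk) mulr0.
  rewrite big1 => [|j _].
    apply/eqP; rewrite -[_ == _]negbK -mcoeff_msupp; apply: contra m1 => /hp /eqP.
    by rewrite -[X in _ == X]muln1 eqn_pmul2l.
  rewrite mcoeffZ mcoeffX; case: eqP => [E|_]; last by rewrite mulr0.
  by move: m1; rewrite -E mdeg1.
have fv u : f (algA_vec T u) = algA_vec S (u *m \matrix_i P i).
  rewrite algA_vecE (raddf_sum f) mulmx_sum_row raddf_sum; apply: eq_bigr => i _.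
  by rewrite /= !linearZ /= fP rowK.
exists (\matrix_i P i) => //.
rewrite -row_free_unit -kermx_eq0; apply/rowV0P => u /sub_kermxP uP.
apply: (@algA_vec_inj T); apply: f_inj.
by rewrite !fv uP mul0mx.
Qed.

Lemma carriesP T S P : strict_lower S -> carries T S P <->
  forall k, algA_vec S (row k P) * algA_vec S (row k (P - T *m P)) = 0.
Proof.
move=> lS; split=> [cP k | cP k i j]; first by apply/algA_vecM_eq0 => //; exact: cP.
by move: i j; apply/algA_vecM_eq0.
Qed.

Lemma gen_sqr_lin T k : strict_lower T ->
  gen T k * algA_vec T (delta_mx 0 k - row k T) = 0.
Proof. by move=> lT; rewrite -rmorphM /= -defrelE // algA_pi_defrel. Qed.

Lemma row_subM T (P : 'M[F]_n) k : row k (P - T *m P) = (delta_mx 0 k - row k T) *m P.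
Proof. by rewrite mulmxBl -rowE -row_mul linearB. Qed.

(** For the inverse matrix, [f] maps the expressions that must vanish in A(T) to the relations of
    A(S), and [f] is injective. *)
Lemma sim_carries T S : strict_lower T -> strict_lower S -> sim T S ->
  exists P Q, [/\ P *m Q = 1%:M, carries T S P & carries S T Q].
Proof.
move=> lT lS /sim_vec[f f_inj [P uP fP]].
exists P, (invmx P); split; first exact: mulmxV.
  apply/carriesP => // k.
  by rewrite row_subM rowE -!fP -rmorphM algA_vec_delta gen_sqr_lin ?rmorph0.
apply/carriesP => // k; apply: f_inj.
rewrite rmorphM /= !fP rmorph0 row_subM rowE -!mulmxA mulVmx // !mulmx1.
by rewrite algA_vec_delta gen_sqr_lin.
Qed.

Lemma sim_refl T : sim T T.
Proof. by exists idfun; split=> //; exists idfun. Qed.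

(** [sim] asks only one direction to preserve degrees, so symmetry is obtained through the matrix
    description. *)
Lemma sim_sym T S : strict_lower T -> strict_lower S -> sim T S -> sim S T.
Proof.
move=> lT lS /(sim_carries lT lS)[P [Q [/mulmx1C QP cP cQ]]].
exact: carries_sim QP cQ cP.
Qed.

Lemma sim_trans T S R : sim T S -> sim S R -> sim T R.
Proof.
move=> [f [f_bij fdeg]] [g [g_bij gdeg]]; exists (g \o f).
by split=> [|d x /fdeg/gdeg]; first exact: bij_comp.
Qed.

(** The tool for telling classes apart: proportionality of products of linear forms is transported
    by an isomorphism. Taking [c = 0] transports vanishing. *)
Lemma sim_mulc T S : strict_lower T -> strict_lower S -> sim T S ->
  exists2 P, P \in unitmx & forall c u v w z,
    (forall i j, (i < j)%N -> mulc T i j u v = c * mulc T i j w z) ->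
    forall i j, (i < j)%N ->
      mulc S i j (u *m P) (v *m P) = c * mulc S i j (w *m P) (z *m P).
Proof.
move=> lT lS /sim_vec[f _ [P uP fP]]; exists P => // c u v w z E i j ij.
apply: algA_vecM_inj => //; rewrite -!fP -!(rmorphM f) -linearZ; congr (f _).
rewrite !algA_vecM scaler_sumr; apply: eq_bigr => l _.
by rewrite scaler_sumr; apply: eq_bigr => k kl; rewrite scalerA E.
Qed.

End Presentation.

(** * Reduction to the normal forms *)

Section Dimension4.
Variable F : fieldType.
Hypothesis two_neq0 : 2%:R != 0 :> F.

Definition low4 (t x y a b c : F) : 'M[F]_4 :=
  mx4 [:: [:: 0; 0; 0; 0]; [:: t; 0; 0; 0]; [:: x; y; 0; 0]; [:: a; b; c; 0]].

Lemma ord4_ind (Q : 'I_4 -> Prop) :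
  Q (@Ordinal 4 0 isT) -> Q (@Ordinal 4 1 isT) -> Q (@Ordinal 4 2 isT) ->
  Q (@Ordinal 4 3 isT) -> forall i, Q i.
Proof.
move=> q0 q1 q2 q3 [[|[|[|[|k]]]] // lt_k4];
  by rewrite (bool_irrelevance lt_k4 isT).
Qed.

Lemma sum_ord4 (V : nmodType) (G : 'I_4 -> V) : \sum_i G i =
  G (@Ordinal 4 0 isT) + G (@Ordinal 4 1 isT) + G (@Ordinal 4 2 isT) +
  G (@Ordinal 4 3 isT).
Proof.
by rewrite !big_ord_recl big_ord0 addr0 !addrA; do !congr (_ + _);
  congr G; apply: val_inj.
Qed.

Lemma low4_strict t x y a b c : strict_lower (low4 t x y a b c).
Proof. by elim/ord4_ind; elim/ord4_ind => //= _; rewrite mxE. Qed.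

Lemma strict_lower_low4 T : strict_lower T -> exists t x y a b c, T = low4 t x y a b c.
Proof.
move=> lT.
exists (T (@Ordinal 4 1 isT) (@Ordinal 4 0 isT)), (T (@Ordinal 4 2 isT) (@Ordinal 4 0 isT)),
  (T (@Ordinal 4 2 isT) (@Ordinal 4 1 isT)), (T (@Ordinal 4 3 isT) (@Ordinal 4 0 isT)),
  (T (@Ordinal 4 3 isT) (@Ordinal 4 1 isT)), (T (@Ordinal 4 3 isT) (@Ordinal 4 2 isT)).
apply/matrixP => i j.
by elim/ord4_ind: i; elim/ord4_ind: j; rewrite mxE //=; apply: lT.
Qed.

(** Matrices are kept as nested lists so that the conditions of [carries] compute to field
    identities. *)
Definition entry (m : seq (seq F)) i j := (nth [::] m i)`_j.

Definition comb m m' k l :=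
  entry m k 0 * entry m' 0 l + entry m k 1 * entry m' 1 l
  + entry m k 2 * entry m' 2 l + entry m k 3 * entry m' 3 l.

Definition carries_entries t s p := forall k i j : 'I_4, (i < j)%N ->
  entry p k i * (entry p k j - comb t p k j) +
  entry p k j * (entry p k i - comb t p k i) +
  entry s j i * (entry p k j * (entry p k j - comb t p k j)) = 0.

Lemma sim_mx4 t s p q : strict_lower (mx4 t) -> strict_lower (mx4 s) ->
  (forall i j : 'I_4, comb p q i j = (i == j)%:R) ->
  carries_entries t s p -> carries_entries s t q -> sim (mx4 t) (mx4 s).
Proof.
have C t' s' p' : carries_entries t' s' p' -> carries (mx4 t') (mx4 s') (mx4 p').
  by move=> c k i j ij; rewrite -[RHS](c k i j ij) /mulc !mxE !sum_ord4 !mxE.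
move=> lt ls pq cp cq.
apply: (@carries_sim _ _ two_neq0 _ _ (mx4 p) (mx4 q)) => //; try exact: C.
by apply/matrixP => i j; rewrite !mxE sum_ord4 !mxE; exact: pq.
Qed.

Ltac ord4_field := rewrite /comb /entry /= ?mulr1n ?mulr0n;
  first [ring | by field; rewrite ?two_neq0 /=; do ?[apply/andP; split]].
(** [p] is the substitution, row by row, and [q] its inverse. *)
Ltac check_sim p q := apply: (@sim_mx4 _ _ p q);
  [exact: low4_strict | exact: low4_strict
  | elim/ord4_ind; elim/ord4_ind; ord4_field
  | elim/ord4_ind; elim/ord4_ind; elim/ord4_ind=> //= _; ord4_field
  | elim/ord4_ind; elim/ord4_ind; elim/ord4_ind=> //= _; ord4_field].

(** The generator [X_2 - t / 2 X_1] has square [t ^ 2 / 4 X_1 ^ 2 = 0]. *)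
Lemma sim_clear_row2 t x y a b c :
  sim (low4 t x y a b c) (low4 0 (x + t * y / 2%:R) y (a + t * b / 2%:R) b c).
Proof.
check_sim ([:: [:: 1; 0; 0; 0]; [:: t / 2%:R; 1; 0; 0]; [:: 0; 0; 1; 0]; [:: 0; 0; 0; 1]])
  ([:: [:: 1; 0; 0; 0]; [:: - t / 2%:R; 1; 0; 0]; [:: 0; 0; 1; 0]; [:: 0; 0; 0; 1]]).
Qed.

Lemma sim_scale d1 d2 d3 d4 x y a b c :
  d1 != 0 -> d2 != 0 -> d3 != 0 -> d4 != 0 ->
  sim (low4 0 x y a b c)
      (low4 0 (x * d3 / d1) (y * d3 / d2) (a * d4 / d1) (b * d4 / d2) (c * d4 / d3)).
Proof.
move=> d1n0 d2n0 d3n0 d4n0.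
check_sim ([:: [:: d1^-1; 0; 0; 0]; [:: 0; d2^-1; 0; 0];
               [:: 0; 0; d3^-1; 0]; [:: 0; 0; 0; d4^-1]])
          ([:: [:: d1; 0; 0; 0]; [:: 0; d2; 0; 0]; [:: 0; 0; d3; 0]; [:: 0; 0; 0; d4]]).
Qed.

(** Here and in the next two swaps, the entry coupling the two exchanged generators is zero, so the
    matrix stays strictly lower triangular. *)
Lemma sim_swap12 x y a b c : sim (low4 0 x y a b c) (low4 0 y x b a c).
Proof.
by check_sim ([:: [:: 0; 1; 0; 0]; [:: 1; 0; 0; 0]; [:: 0; 0; 1; 0]; [:: 0; 0; 0; 1]] : seq (seq F))
          ([:: [:: 0; 1; 0; 0]; [:: 1; 0; 0; 0]; [:: 0; 0; 1; 0]; [:: 0; 0; 0; 1]] : seq (seq F)).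
Qed.

Lemma sim_swap23 a b c : sim (low4 0 0 0 a b c) (low4 0 0 0 a c b).
Proof.
by check_sim ([:: [:: 1; 0; 0; 0]; [:: 0; 0; 1; 0]; [:: 0; 1; 0; 0]; [:: 0; 0; 0; 1]] : seq (seq F))
          ([:: [:: 1; 0; 0; 0]; [:: 0; 0; 1; 0]; [:: 0; 1; 0; 0]; [:: 0; 0; 0; 1]] : seq (seq F)).
Qed.

Lemma sim_swap34 x y a b : sim (low4 0 x y a b 0) (low4 0 a b x y 0).
Proof.
by check_sim ([:: [:: 1; 0; 0; 0]; [:: 0; 1; 0; 0]; [:: 0; 0; 0; 1]; [:: 0; 0; 1; 0]] : seq (seq F))
          ([:: [:: 1; 0; 0; 0]; [:: 0; 1; 0; 0]; [:: 0; 0; 0; 1]; [:: 0; 0; 1; 0]] : seq (seq F)).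
Qed.

(** Since [l_3 = x X_1] has square zero, completing the square in [X_3] clears the row. *)
Lemma sim_clear_row3 x a b c :
  sim (low4 0 x 0 a b c) (low4 0 0 0 (a + c * x / 2%:R) b c).
Proof.
by check_sim ([:: [:: 1; 0; 0; 0]; [:: 0; 1; 0; 0]; [:: x / 2%:R; 0; 1; 0]; [:: 0; 0; 0; 1]])
          ([:: [:: 1; 0; 0; 0]; [:: 0; 1; 0; 0]; [:: - x / 2%:R; 0; 1; 0]; [:: 0; 0; 0; 1]]).
Qed.

(* Both X_3 - (X_1 + X_2) / 2 and X_1 / 4 + X_2 have square X_1 X_2 / 2. *)
Lemma sim_matD_quarter :
  sim (low4 0 1 1 (- 2%:R^-1) (- 2%:R^-1) 1) (matD (4%:R^-1 : F)).
Proof.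
have four_neq0 : 4%:R != 0 :> F by rewrite (natrM _ 2 2) mulf_neq0.
have eight_neq0 : 8%:R != 0 :> F by rewrite (natrM _ 2 4) mulf_neq0.
(* Matching the completed generators sends [X_4] to [X_4 + (l - m) / 2] with
   [l = X_3 - (X_1 + X_2) / 2] and [m = X_1 / 4 + X_2]. *)
by check_sim ([:: [:: 1; 0; 0; 0]; [:: 0; 1; 0; 0]; [:: 0; 0; 1; 0];
       [:: - (3%:R / 8%:R); - (3%:R / 4%:R); 2%:R^-1; 1]] : seq (seq F))
     ([:: [:: 1; 0; 0; 0]; [:: 0; 1; 0; 0]; [:: 0; 0; 1; 0];
       [:: 3%:R / 8%:R; 3%:R / 4%:R; - 2%:R^-1; 1]] : seq (seq F)).
Qed.

(* The rescaling X_1 := s X_1, X_2 := X_2 / s preserves the square X_1 X_2 / 2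
   of X_3 - (X_1 + X_2) / 2. *)
Lemma sim_matC a b : 2%:R * b + 1 != 0 ->
  sim (low4 0 1 1 a b 1) (matC ((2%:R * b + 1) * (a + 2%:R^-1) - 2%:R^-1)).
Proof.
(* With [Y_3 = X_3 - (X_1 + X_2) / 2], [l_4] is [(a + 1/2) X_1 + (b + 1/2) X_2 + Y_3]. Dividing the
   second coefficient by [s] makes it 1/2, which is a zero entry in terms of [X_3]. *)
set s := 2%:R * b + 1 => s0.
have -> : b = (s - 1) / 2%:R by rewrite /s; field.
by check_sim ([:: [:: s; 0; 0; 0]; [:: 0; s^-1; 0; 0];
                  [:: (s - 1) / 2%:R; (s^-1 - 1) / 2%:R; 1; 0]; [:: 0; 0; 0; 1]])
             ([:: [:: s^-1; 0; 0; 0]; [:: 0; s; 0; 0];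
                  [:: (s^-1 - 1) / 2%:R; (s - 1) / 2%:R; 1; 0]; [:: 0; 0; 0; 1]]).
Qed.

End Dimension4.

(** * Case analysis leading to the normal forms *)

Section Classification.
Variable F : fieldType.
Hypothesis two_neq0 : 2%:R != 0 :> F.

Inductive normal_form : seq nat -> 'M[F]_4 -> Prop :=
  | NormalZero : normal_form [:: 0%N] 0
  | NormalB : normal_form [:: 4%N] matB
  | NormalB' : normal_form [:: 4%N] matB'
  | NormalC a : normal_form [:: 3%N; 4%N] (matC a)
  | NormalD u : u != 0 -> normal_form [:: 3%N] (matD u).

Lemma low4_0 : low4 0 0 0 0 0 0 = 0 :> 'M[F]_4.
Proof. by apply/matrixP => i j; elim/ord4_ind: i; elim/ord4_ind: j; rewrite !mxE. Qed.

Lemma normal_form_strict W N : normal_form W N -> strict_lower N.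
Proof.
by case=> [||| a | u _]; [rewrite -low4_0 | | | |]; apply: low4_strict.
Qed.

Definition reduces W T := exists2 N, normal_form W N & sim T N.

Lemma reduces_sim W T S : sim T S -> reduces W S -> reduces W T.
Proof. by move=> TS [N nN SN]; exists N => //; exact: sim_trans TS SN. Qed.

Lemma normal_form_reduces W N : normal_form W N -> reduces W N.
Proof. by exists N => //; exact: sim_refl. Qed.

Lemma reduces0 a : reduces [:: 0%N] (low4 0 0 0 a 0 0).
Proof.
apply: reduces_sim (sim_swap34 two_neq0 _ _ _ _) _.
apply: reduces_sim (sim_clear_row3 two_neq0 _ _ _ _) _.
rewrite mul0r mul0r addr0 low4_0; exact/normal_form_reduces/NormalZero.
Qed.

Lemma reduces_B (a b : F) : a != 0 -> b != 0 -> reduces [:: 4%N] (low4 0 0 0 a b 0).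
Proof.
move=> a0 b0.
apply: reduces_sim (sim_scale two_neq0 _ _ _ _ _ a0 b0 (oner_neq0 F) (oner_neq0 F)) _.
rewrite !mul0r !mulr1 !divff //; exact/normal_form_reduces/NormalB.
Qed.

(** [X_1], [X_2], [X_3] all have square zero and can be permuted and rescaled, so only the number of
    nonzero entries matters: two give [matB], three [matB']. *)
Lemma reduces4 (a b c : F) :
  [|| (a != 0) && (b != 0), (a != 0) && (c != 0) | (b != 0) && (c != 0)] ->
  reduces [:: 4%N] (low4 0 0 0 a b c).
Proof.
have [-> /= | a0] := eqVneq a 0.
  move=> /andP[b0 c0]; apply: reduces_sim (sim_swap12 two_neq0 _ _ _ _ _) _.
  by apply: reduces_sim (sim_swap23 two_neq0 _ _ _) _; exact: reduces_B.
have [-> /= | b0 _] := eqVneq b 0.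
  rewrite orbF => c0; apply: reduces_sim (sim_swap23 two_neq0 _ _ _) _.
  exact: reduces_B.
have [-> | c0] := eqVneq c 0; first exact: reduces_B.
apply: reduces_sim (sim_scale two_neq0 _ _ _ _ _ a0 b0 c0 (oner_neq0 F)) _.
rewrite !mul0r !mulr1 !divff //; exact/normal_form_reduces/NormalB'.
Qed.

Lemma reduces3 (x y a b : F) : x != 0 -> y != 0 -> a != 0 -> b != 0 ->
  reduces [:: 3%N] (low4 0 x y a b 0).
Proof.
move=> x0 y0 a0 b0; have yb0 : y / b != 0 by rewrite mulf_neq0 ?invr_neq0.
(* The factor [y / b] normalises the entry [b] to 1; the ratio [a y / (b x)] survives as the
   parameter. *)
apply: reduces_sim (sim_scale two_neq0 _ _ _ _ _ x0 y0 (oner_neq0 F) yb0) _.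
have u0 : a * (y / b) / x != 0 by rewrite !mulf_neq0 ?invr_neq0.
rewrite !mulr1 !mul0r [b * _]mulrC (divfK b0) !divff //.
exact/normal_form_reduces/(NormalD u0).
Qed.

Lemma sim_scale_unit (x y a b c : F) : x != 0 -> y != 0 -> c != 0 ->
  sim (low4 0 x y a b c) (low4 0 1 1 (a / (c * x)) (b / (c * y)) 1).
Proof.
move=> x0 y0 c0.
have := sim_scale two_neq0 x y a b c x0 y0 (oner_neq0 F) (invr_neq0 c0).
by rewrite !mulr1 !divff ?oner_neq0 // !invfM !mulrA.
Qed.

(** The two quantities are the values of [Delta2] at the leader in row 4, column 3. After scaling,
    [sim_matC] uses the second; swapping [X_1] and [X_2] handles the first. *)
Lemma reduces34 (x y a b c : F) : x != 0 -> y != 0 -> c != 0 ->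
  (2%:R * a + c * x != 0) || (2%:R * b + c * y != 0) ->
  reduces [:: 3%N; 4%N] (low4 0 x y a b c).
Proof.
move=> x0 y0 c0 h; apply: reduces_sim (sim_scale_unit _ _ x0 y0 c0) _.
have E (z d : F) : z != 0 -> 2%:R * d + c * z != 0 -> 2%:R * (d / (c * z)) + 1 != 0.
  move=> z0; apply: contra_neq => e.
  have -> : 2%:R * d + c * z = (2%:R * (d / (c * z)) + 1) * (c * z).
    by field; rewrite c0 z0.
  by rewrite e mul0r.
have [e | e] := orP h; last first.
  apply: reduces_sim (sim_matC two_neq0 _ (E _ _ y0 e)) _.
  exact/normal_form_reduces/NormalC.
apply: reduces_sim (sim_swap12 two_neq0 _ _ _ _ _) _.
apply: reduces_sim (sim_matC two_neq0 _ (E _ _ x0 e)) _.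
exact/normal_form_reduces/NormalC.
Qed.

(** A third row with at most one nonzero entry can be cleared. Otherwise the split is on [c]: for
    [c = 0] rows 3 and 4 are interchangeable, for [c != 0] the values of [Delta2] decide. *)
Lemma reduces_low4 (x y a b c : F) : exists W, reduces W (low4 0 x y a b c).
Proof.
have row3_0 a' b' c' : exists W, reduces W (low4 0 0 0 a' b' c').
  have [h|] := boolP [|| (a' != 0) && (b' != 0), (a' != 0) && (c' != 0)
                       | (b' != 0) && (c' != 0)].
    by exists [:: 4%N]; exact: reduces4.
  have [-> | a0] := eqVneq a' 0; last first.
    case: eqVneq => [->|//]; case: eqVneq => [-> _|//].
    by exists [:: 0%N]; exact: reduces0.
  move=> h; exists [:: 0%N]; apply: reduces_sim (sim_swap12 two_neq0 _ _ _ _ _) _.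
  have [-> | b0] := eqVneq b' 0; last first.
    by move: h; rewrite b0 /= negbK => /eqP ->; exact: reduces0.
  apply: reduces_sim (sim_swap23 two_neq0 _ _ _) _.
  by apply: reduces_sim (sim_swap12 two_neq0 _ _ _ _ _) _; exact: reduces0.
have y0 x' a' b' c' : exists W, reduces W (low4 0 x' 0 a' b' c').
  have [W hW] := row3_0 (a' + c' * x' / 2%:R) b' c'; exists W.
  exact: reduces_sim (sim_clear_row3 two_neq0 _ _ _ _) hW.
have [-> | yn0] := eqVneq y 0; first exact: y0.
have [-> | xn0] := eqVneq x 0.
  have [W hW] := y0 y b a c; exists W.
  exact: reduces_sim (sim_swap12 two_neq0 _ _ _ _ _) hW.
have [-> | cn0] := eqVneq c 0.
  have [-> | bn0] := eqVneq b 0.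
    have [W hW] := y0 a x y 0; exists W.
    exact: reduces_sim (sim_swap34 two_neq0 _ _ _ _) hW.
  have [-> | an0] := eqVneq a 0; last by exists [:: 3%N]; exact: reduces3.
  have [W hW] := y0 b y x 0; exists W.
  apply: reduces_sim (sim_swap34 two_neq0 _ _ _ _) _.
  exact: reduces_sim (sim_swap12 two_neq0 _ _ _ _ _) hW.
have [h|] := boolP ((2%:R * a + c * x != 0) || (2%:R * b + c * y != 0)).
  by exists [:: 3%N; 4%N]; exact: reduces34.
rewrite negb_or !negbK => /andP[/eqP ea /eqP eb].
(* When both values of [Delta2] vanish, scaling turns [l_4] into [X_3 - (X_1 + X_2) / 2], the case
   of [sim_matD_quarter]. *)
exists [:: 3%N]; apply: reduces_sim (sim_scale_unit _ _ xn0 yn0 cn0) _.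
have half (z d : F) : z != 0 -> 2%:R * d + c * z = 0 -> d / (c * z) = - 2%:R^-1.
  move=> zn0 e; have -> : d = - (c * z) / 2%:R.
    by rewrite -[LHS](mulKf two_neq0) (canRL (addrK _) e) sub0r mulrC.
  by field; rewrite two_neq0 cn0 zn0.
rewrite !half //.
apply: reduces_sim (sim_matD_quarter two_neq0) _; apply/normal_form_reduces/NormalD.
by rewrite invr_neq0 // (natrM _ 2 2) mulf_neq0.
Qed.

Lemma reduces_strict T : strict_lower T -> exists W, reduces W T.
Proof.
move=> /strict_lower_low4[t [x [y [a [b [c ->]]]]]].
have [W hW] := reduces_low4 (x + t * y / 2%:R) y (a + t * b / 2%:R) b c.
by exists W; apply: reduces_sim (sim_clear_row2 two_neq0 _ _ _ _ _ _) hW.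
Qed.

End Classification.

(** * Invariance of the wall *)

Section Invariance.
Variable F : fieldType.
Hypothesis two_neq0 : 2%:R != 0 :> F.

Local Notation o0 := (@Ordinal 4 0 isT).
Local Notation o1 := (@Ordinal 4 1 isT).
Local Notation o2 := (@Ordinal 4 2 isT).
Local Notation o3 := (@Ordinal 4 3 isT).

Definition square_zero (T : 'M[F]_4) (u : 'rV[F]_4) :=
  forall i j : 'I_4, (i < j)%N -> mulc T i j u u = 0.

Lemma sim_square_zero T S : strict_lower T -> strict_lower S -> sim T S ->
  exists2 P : 'M[F]_4, P \in unitmx & forall u, square_zero T u -> square_zero S (u *m P).
Proof.
move=> lT lS /(sim_mulc two_neq0 lT lS)[P uP hP]; exists P => // u u0 i j ij.
by rewrite (hP 0 u u u u) ?mul0r // => k l kl; rewrite u0 ?mul0r.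
Qed.

(** The entrywise form of 1-REF for nonzero matrices: no leader lies in column 1, and the [Delta2]
    condition is [2 x != 0] or [2 a != 0] for a leader in column 2. *)
Definition reduced4 (x y a b c : F) :=
  (x = 0 /\ y = 0 \/ x != 0 /\ y != 0) /\
  (c != 0 /\ (2%:R * a + c * x != 0 \/ 2%:R * b + c * y != 0)
   \/ [/\ c = 0, a != 0 & b != 0]).

(** For reduced entries, row 3 starts the wall when [x != 0], and row 4 then joins it exactly when
    its leader is in column 3. *)
Definition wall4 (x c : F) :=
  if x == 0 then [:: 4%N] else if c == 0 then [:: 3%N] else [:: 3%N; 4%N].

Lemma reduced4_reduces x y a b c : reduced4 x y a b c ->
  reduces (wall4 x c) (low4 0 x y a b c).
Proof.
rewrite /wall4 => -[[[-> ->]|[x0 y0]]]; last rewrite (negPf x0).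
  rewrite eqxx !mulr0 !addr0 !mulf_eq0 (negPf two_neq0) => h; apply: reduces4 => //.
  by case: h => [[-> [->|->]]|[_ -> ->]]; rewrite ?orbT.
case=> [[c0 /orP h]|[-> a0 b0]]; first by rewrite (negPf c0); exact: reduces34.
by rewrite eqxx; exact: reduces3.
Qed.

Lemma normal_form_reduced4 W N : normal_form W N -> W = [:: 0%N] /\ N = 0 \/
  exists x y a b c, [/\ N = low4 0 x y a b c, reduced4 x y a b c & W = wall4 x c].
Proof.
case=> [|||a|u u0]; [by left | | | | ]; right.
- exists 0, 0, 1, 1, 0; split=> //; last by rewrite /wall4 eqxx.
  by split; [left | right; split; rewrite ?oner_neq0].
- exists 0, 0, 1, 1, 1; split=> //; last by rewrite /wall4 eqxx.
  by split; [left | left; split; [|left]; rewrite ?oner_neq0 // mulr1 mulr0 addr0].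
- exists 1, 1, a, 0, 1; split=> //; last by rewrite /wall4 (negPf (oner_neq0 F)).
  by split; [right | left; split; [|right]]; rewrite ?oner_neq0 // mulr1 mulr0 add0r oner_neq0.
exists 1, 1, u, 1, 0; split=> //; last by rewrite /wall4 (negPf (oner_neq0 F)) eqxx.
by split; right; split; rewrite ?oner_neq0.
Qed.

(** * Elements of square zero in reduced form *)

Section SquareZero.
Variables (x y a b c : F) (u : 'rV[F]_4).
Hypothesis red : reduced4 x y a b c.

Let double_coord (z w l : F) : z * w + w * z + l * (w * w) = 0 -> w != 0 ->
  z + z = - (l * w).
Proof.
move=> e w0; apply: (mulIf w0); apply/eqP; rewrite -subr_eq0 -[X in _ == X]e.
by apply/eqP; ring.
Qed.

(* The coefficient at X_1 X_2 only matters when c = 0; leaving it out otherwise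
   makes the lemma apply to all u whose square is a multiple of X_1 X_2. *)
Lemma square_zero_last :
  (forall i j : 'I_4, (i < j)%N -> c = 0 \/ (1 < j)%N ->
    mulc (low4 0 x y a b c) i j u u = 0) -> u 0 o3 = 0.
Proof.
move=> sq; apply/eqP/negPn/negP => u3.
have sq' i (j : 'I_4) ij (j1 : (1 < j)%N) := sq i j ij (or_intror j1).
have := sq o0 o1 isT; have := sq' o0 o2 isT isT; have := sq' o1 o2 isT isT.
have := sq' o2 o3 isT isT; have := sq' o1 o3 isT isT.
have := sq' o0 o3 isT isT; rewrite /mulc !mxE /=.
move=> /double_coord/(_ u3) e0 /double_coord/(_ u3) e1 /double_coord/(_ u3) e2.
move=> m12 m02 m01.
(* By [e0], [e1], [e2], [u] is a multiple of [X_4 - l_4 / 2], so the other coefficients of its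
   square are those of [l_4 ^ 2] up to a nonzero scalar: [2 a b], [c (2 a + c x)] and
   [c (2 b + c y)]. *)
have scaled (k z w : F) : z = 0 -> w = k * z -> w = 0 by move=> -> ->; rewrite mulr0.
have u33 : u 0 o3 * u 0 o3 != 0 by rewrite mulf_neq0.
have ab : c = 0 -> a * b = 0.
  move=> c0; apply: (mulIf u33); rewrite mul0r.
  apply: (scaled 2%:R _ _ (m01 (or_introl c0))).
  transitivity ((- (a * u 0 o3)) * (- (b * u 0 o3))); first by ring.
  by rewrite -e0 -e1; ring.
have ac : c * (2%:R * a + c * x) = 0.
  apply: (mulIf u33); rewrite mul0r; apply: (scaled 4%:R _ _ m02).
  transitivity (2%:R * (- (a * u 0 o3)) * (- (c * u 0 o3)) + x * (- (c * u 0 o3)) * (- (c * u 0 o3))).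
    by ring.
  by rewrite -e0 -e2; ring.
have bc : c * (2%:R * b + c * y) = 0.
  apply: (mulIf u33); rewrite mul0r; apply: (scaled 4%:R _ _ m12).
  transitivity (2%:R * (- (b * u 0 o3)) * (- (c * u 0 o3)) + y * (- (c * u 0 o3)) * (- (c * u 0 o3))).
    by ring.
  by rewrite -e1 -e2; ring.
case: red => _ [[c0 [] /eqP []]|[c0 a0 b0]].
- by apply: (mulfI c0); rewrite ac mulr0.
- by apply: (mulfI c0); rewrite bc mulr0.
by move/eqP: (ab c0); rewrite mulf_eq0 (negPf a0) (negPf b0).
Qed.

(** If [u_3 != 0], the coordinates on [X_1] and [X_2] are [- x u_3 / 2] and [- y u_3 / 2], and the
    coefficient at [X_1 X_2] forces [x y = 0]. *)
Lemma square_zero_third : x != 0 -> square_zero (low4 0 x y a b c) u ->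
  u 0 o2 = 0.
Proof.
move=> x0 sq; case: red => [[[x1]|[_ y0]] _]; first by rewrite x1 eqxx in x0.
apply/eqP/negPn/negP => u2.
have := sq o1 o2 isT; have := sq o0 o2 isT; have := sq o0 o1 isT; rewrite /mulc !mxE /=.
move=> m01 /double_coord/(_ u2) e0 /double_coord/(_ u2) e1.
have : (x * u 0 o2) * (y * u 0 o2) = 0.
  rewrite -[LHS]mulrNN -e0 -e1 -(mulr0 (2%:R : F)) -[X in _ = _ * X]m01; ring.
by apply/eqP; rewrite !mulf_neq0.
Qed.

End SquareZero.

(** * Leaders, 1-REF and walls for four generators *)

Lemma unitmx_mul_eq0 (P : 'M[F]_4) (v : 'cV[F]_4) : P \in unitmx -> P *m v = 0 -> v = 0.
Proof. by move=> uP Pv; rewrite -(mulKmx uP v) Pv mulmx0. Qed.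

Lemma unitmx_col_neq0 (P : 'M[F]_4) j : P \in unitmx -> (forall i, P i j = 0) -> False.
Proof.
move=> uP Pj; have /(unitmx_mul_eq0 uP) : P *m delta_mx j 0 = 0 :> 'cV_4.
  by rewrite -colE; apply/matrixP => i k; rewrite !mxE.
by move/matrixP/(_ j 0); rewrite !mxE !eqxx => /eqP; rewrite oner_eq0.
Qed.

Lemma lead4 (T : 'M[F]_4) r : lead T r =
  if T r o3 != 0 then 4%N else if T r o2 != 0 then 3%N else
  if T r o1 != 0 then 2%N else (T r o0 != 0).
Proof.
rewrite /lead big_mkcond !big_ord_recl big_ord0 /=.
rewrite (_ : ord0 = o0); last exact: val_inj.
rewrite (_ : lift o0 ord0 = o1); last exact: val_inj.
rewrite (_ : lift o0 (lift ord0 ord0) = o2); last exact: val_inj.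
rewrite (_ : lift o0 (lift ord0 (lift ord0 ord0)) = o3); last exact: val_inj.
by case: (T r o3 != 0); case: (T r o2 != 0); case: (T r o1 != 0); case: (T r o0 != 0).
Qed.

Lemma enum_ord4 : enum 'I_4 = [:: o0; o1; o2; o3].
Proof. by apply: (inj_map val_inj); rewrite val_enum_ord. Qed.

Lemma row_eq0 (T : 'M[F]_4) r :
  (row r T == 0) = [&& T r o0 == 0, T r o1 == 0, T r o2 == 0 & T r o3 == 0].
Proof.
apply/eqP/and4P => [/rowP h | [/eqP h0 /eqP h1 /eqP h2 /eqP h3]].
  by split; [move: (h o0) | move: (h o1) | move: (h o2) | move: (h o3)]; rewrite !mxE => ->.
by apply/rowP; elim/ord4_ind; rewrite !mxE.
Qed.

Lemma one_ref_low4 x y a b c : reduced4 x y a b c -> one_ref (low4 0 x y a b c).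
Proof.
move=> [hxy habc]; split; first exact: low4_strict.
right.
have abn0 : [&& a == 0, b == 0, c == 0 & true] = false.
  by case: habc => [[/negPf c0 _]|[_ /negPf a0 _]]; rewrite ?c0 ?a0 ?andbF.
split.
- move=> r r' /eqP; rewrite row_eq0 row_eq0.
  elim/ord4_ind: r; elim/ord4_ind: r'; rewrite !mxE /= ?eqxx ?abn0 //=.
  by move=> ->.
- move=> r [k lt_k4]; elim/ord4_ind: r; rewrite lead4 !mxE /= ?eqxx //=.
  + case: hxy => [[-> ->]|[x0 y0]]; first by rewrite eqxx.
    rewrite y0 => -[?]; subst k; split=> //; exists o0; split=> //.
    by rewrite /Delta2 !mxE /= mulr0 addr0 mulf_neq0.
  case: habc => [[c0 h]|[-> a0 b0]].
    rewrite c0 => -[?]; subst k; split=> //.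
    by case: h => h; [exists o0 | exists o1]; split=> //; rewrite /Delta2 !mxE.
  rewrite eqxx b0 => -[?]; subst k; split=> //; exists o0; split=> //.
  by rewrite /Delta2 !mxE /= mulr0 addr0 mulf_neq0.
- move=> r r'; rewrite (row_eq0 _ r) (row_eq0 _ r') (lead4 _ r) (lead4 _ r').
  elim/ord4_ind: r; elim/ord4_ind: r' => //= _; rewrite !mxE /= ?eqxx //= => _ _.
  case: habc => [[-> _]|[-> _ ->]]; last by rewrite eqxx; case: (y != 0); case: (x != 0).
  by case: (y != 0); case: (x != 0).
Qed.

Lemma one_ref_inv S : one_ref S ->
  S = 0 \/ exists x y a b c, S = low4 0 x y a b c /\ reduced4 x y a b c.
Proof.
move=> [lS [->|[h1 h2 _]]]; first by left.
have [-> | S0] := eqVneq S 0; [by left | right].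
have [t [x [y [a [b [c E]]]]]] := strict_lower_low4 lS.
have no_lead1 r : lead S r <> 1%N by move/(h2 r o0) => -[].
have t0 : t = 0.
  apply/eqP/negPn/negP => t0; apply: (no_lead1 o1).
  by rewrite E lead4 !mxE /= eqxx t0.
rewrite {}t0 in E; exists x, y, a, b, c; split=> //.
have hxy : x = 0 /\ y = 0 \/ x != 0 /\ y != 0.
  have [y0 | y0] := eqVneq y 0.
    left; split=> //; apply/eqP/negPn/negP => x0; apply: (no_lead1 o2).
    by rewrite E lead4 !mxE /= eqxx y0 eqxx x0.
  have [] := h2 o2 o1; first by rewrite E lead4 !mxE /= eqxx y0.
  move=> _ [i [i1]]; have -> : i = o0 by apply: val_inj; case: i i1 => -[|].
  rewrite /Delta2 E !mxE /= mulr0 addr0 mulf_eq0 (negPf two_neq0) /= => x0.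
  by right.
split=> //; have [c0 | c0] := eqVneq c 0; [right | left].
  have [b0 | b0] := eqVneq b 0.
    have [a0 | a0] := eqVneq a 0.
      exfalso; case: hxy => [[x0 y0]|[x0 y0]].
        by move: S0; rewrite E x0 y0 a0 b0 c0 low4_0 eqxx.
      (* A zero row 4 below a nonzero row 3 would violate the order of the zero rows. *)
      suff : (o3 < o2)%N by [].
      apply: h1; first by apply/eqP; rewrite row_eq0 E !mxE /= a0 b0 c0 !eqxx.
      by rewrite row_eq0 E !mxE /= (negPf x0).
    case: (no_lead1 o3); by rewrite E lead4 !mxE /= c0 b0 eqxx a0.
  split=> //.
  have [] := h2 o3 o1; first by rewrite E lead4 !mxE /= c0 eqxx b0.
  move=> _ [i [i1]]; have -> : i = o0 by apply: val_inj; case: i i1 => -[|].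
  by rewrite /Delta2 E !mxE /= mulr0 addr0 mulf_eq0 (negPf two_neq0).
split=> //.
have [] := h2 o3 o2; first by rewrite E lead4 !mxE /= eqxx c0.
move=> _ [i [i1]]; rewrite /Delta2 E !mxE /=.
by case: i i1 => -[|[|]] //= _ _ h; [left | right].
Qed.

Lemma wall_ref_low4 x y a b c : reduced4 x y a b c ->
  ~ sim (low4 0 x y a b c) 0 -> wall_ref (low4 0 x y a b c) = wall4 x c.
Proof.
move=> [hxy habc] n0; rewrite /wall_ref asboolF // enum_ord4 /=.
rewrite (row_eq0 _ o0) (row_eq0 _ o1) (row_eq0 _ o2) (row_eq0 _ o3) !mxE /= !eqxx /=.
have -> : [&& a == 0, b == 0, c == 0 & true] = false.
  by case: habc => [[/negPf c0 _]|[_ /negPf a0 _]]; rewrite ?c0 ?a0 ?andbF.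
rewrite /wall4 /wall_next.
case: hxy => [[-> ->]|[/negPf x0 /negPf y0]].
  by rewrite eqxx /= enum_ord4 /=.
rewrite x0 /= enum_ord4 /= lead4 !mxE /=.
case: habc => [[/negPf -> _]|[-> _ ->]]; by rewrite !eqxx.
Qed.

Lemma wall_zero : wall_ref (0 : 'M[F]_4) = [:: 0%N].
Proof. by rewrite /wall_ref asboolT //; exact: sim_refl. Qed.

(** * Separating the walls *)

Lemma square_zero_delta (T : 'M[F]_4) (k : 'I_4) :
  (forall i : 'I_4, (i < k)%N -> T k i = 0) ->
  square_zero T (delta_mx 0 k).
Proof.
move=> Tk i j; rewrite /mulc !mxE !eqxx /=; have [-> ik | _ _] := eqVneq j k.
  have -> : (i == k) = false by rewrite -(inj_eq val_inj) /= ltn_eqF.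
  by rewrite Tk // !(mulr0n, mul0r, mulr0, addr0).
by rewrite !(mulr0n, mul0r, mulr0, addr0).
Qed.

Lemma row_mulmx_delta (P : 'M[F]_4) (k j : 'I_4) :
  (delta_mx 0 k *m P : 'rV_4) 0 j = P k j.
Proof. by rewrite -rowE mxE. Qed.

(** All generators of A(0) have square zero, so their images have no [X_4] component and the last
    column of [P] vanishes. *)
Lemma zero_not_sim_low4 x y a b c : reduced4 x y a b c -> ~ sim 0 (low4 0 x y a b c).
Proof.
rewrite -low4_0 => red s.
have [||P uP hP] := sim_square_zero _ _ s; try exact: low4_strict.
apply: (unitmx_col_neq0 (j := o3) uP) => k; rewrite -row_mulmx_delta.
apply: (square_zero_last red) => i j ij _; apply: hP => //.
by apply: square_zero_delta => l _; rewrite low4_0 mxE.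
Qed.

(** Three independent generators of square zero would land in the span of [X_1] and [X_2]. *)
Lemma low4_not_sim_third a b c x' y' a' b' c' : reduced4 x' y' a' b' c' -> x' != 0 ->
  ~ sim (low4 0 0 0 a b c) (low4 0 x' y' a' b' c').
Proof.
move=> red x'0 s.
have [||P uP hP] := sim_square_zero _ _ s; try exact: low4_strict.
have sq (k : 'I_4) : (k < 3)%N -> square_zero (low4 0 x' y' a' b' c') (delta_mx 0 k *m P).
  move=> k3; apply/hP/square_zero_delta => l; move: k3.
  by elim/ord4_ind: k => //= _; elim/ord4_ind: l => //= _; rewrite !mxE.
have P3 (k : 'I_4) : (k < 3)%N -> P k o3 = 0.
  by move=> /sq h; rewrite -row_mulmx_delta (square_zero_last red) // => i j ij _; exact: h.
have P2 (k : 'I_4) : (k < 3)%N -> P k o2 = 0.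
  by move=> /sq h; rewrite -row_mulmx_delta (square_zero_third red).
(* Columns 3 and 4 of P are both supported in the last row. *)
have /(unitmx_mul_eq0 uP)/colP v0 :
    P *m (P o3 o3 *: delta_mx o2 0 - P o3 o2 *: delta_mx o3 0) = 0 :> 'cV_4.
  rewrite mulmxBr -!scalemxAr -!colE; apply/colP; elim/ord4_ind; rewrite !mxE.
  - by rewrite (P2 o0) ?(P3 o0) // !mulr0 subr0.
  - by rewrite (P2 o1) ?(P3 o1) // !mulr0 subr0.
  - by rewrite (P2 o2) ?(P3 o2) // !mulr0 subr0.
  by rewrite mulrC subrr.
apply: (unitmx_col_neq0 (j := o2) uP); elim/ord4_ind; try exact: P2.
by have := v0 o3; rewrite !mxE /= mulr0 mulr1 sub0r => /eqP; rewrite oppr_eq0 => /eqP.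
Qed.

(** The images of [X_1] and [X_2] lie in the span of [X_1] and [X_2], so the line of [X_1 X_2] is
    preserved. In the source, elements with square in that line span all generators; in the target
    they have no [X_4] component. *)
Lemma low4_not_sim_last x y a b x' y' a' b' c' :
  reduced4 x' y' a' b' c' -> x' != 0 -> c' != 0 ->
  ~ sim (low4 0 x y a b 0) (low4 0 x' y' a' b' c').
Proof.
move=> red x'0 c'0; set T := low4 0 x y a b 0; set S := low4 _ _ _ _ _ _ => TS.
have [||P uP hP] := sim_mulc two_neq0 _ _ TS; try exact: low4_strict.
have sq (k : 'I_4) : (k < 2)%N -> square_zero S (delta_mx 0 k *m P).
  move=> k2 i j ij; rewrite (hP 0 _ _ (delta_mx 0 k) (delta_mx 0 k)) ?mul0r //.
  move=> {ij} {}i {}j ij.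
  rewrite mul0r; apply: square_zero_delta ij => l; move: k2.
  by elim/ord4_ind: k => //= _; elim/ord4_ind: l => //= _; rewrite !mxE.
have P3 (k : 'I_4) : (k < 2)%N -> P k o3 = 0.
  by move=> /sq h; rewrite -row_mulmx_delta (square_zero_last red) // => i j ij _; exact: h.
have P2 (k : 'I_4) : (k < 2)%N -> P k o2 = 0.
  by move=> /sq h; rewrite -row_mulmx_delta (square_zero_third red).
have last0 d v :
    (forall i j : 'I_4, (i < j)%N ->
       mulc T i j v v = d * mulc T i j (delta_mx 0 o0) (delta_mx 0 o1)) ->
    (v *m P) 0 o3 = 0.
  move=> /hP hv; apply: (square_zero_last red) => i j ij [c'1|j1].
    by rewrite c'1 eqxx in c'0.
  rewrite hv // /mulc !row_mulmx_delta.
  move: j1 {ij}; elim/ord4_ind: j => //= _;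
    by rewrite !(P2 o0, P2 o1, P3 o0, P3 o1) // !(mulr0, mul0r, addr0).
have y3 : (((2%:R *: delta_mx 0 o2 - x *: delta_mx 0 o0 - y *: delta_mx 0 o1)
    : 'rV_4) *m P) 0 o3 = 0.
  apply: (last0 (2%:R * x * y)).
  by elim/ord4_ind; elim/ord4_ind => //= _; rewrite /mulc !mxE /= ?mulr1n ?mulr0n; ring.
have y4 : (((2%:R *: delta_mx 0 o3 - a *: delta_mx 0 o0 - b *: delta_mx 0 o1)
    : 'rV_4) *m P) 0 o3 = 0.
  (* As for [X_3] above, [2 X_4 - l_4] has square [l_4 ^ 2 = 2 a b X_1 X_2]. *)
  apply: (last0 (2%:R * a * b)).
  by elim/ord4_ind; elim/ord4_ind => //= _; rewrite /mulc !mxE /= ?mulr1n ?mulr0n; ring.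
have lin k p q : (((2%:R *: delta_mx 0 k - p *: delta_mx 0 o0 - q *: delta_mx 0 o1)
    : 'rV_4) *m P) 0 o3 = 2%:R * P k o3.
  rewrite !mulmxBl -!scalemxAl -!rowE !mxE [P o0 _]P3 // [P o1 _]P3 //.
  by rewrite !mulr0 !subr0.
apply: (unitmx_col_neq0 (j := o3) uP); elim/ord4_ind; try exact: P3.
  by apply: (mulfI two_neq0); rewrite mulr0 -y3 lin.
by apply: (mulfI two_neq0); rewrite mulr0 -y4 lin.
Qed.

Lemma sim_wall4 x y a b c x' y' a' b' c' : reduced4 x y a b c -> reduced4 x' y' a' b' c' ->
  sim (low4 0 x y a b c) (low4 0 x' y' a' b' c') -> wall4 x c = wall4 x' c'.
Proof.
move=> red red' s.
have s' : sim (low4 0 x' y' a' b' c') (low4 0 x y a b c).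
  by apply: sim_sym s => //; exact: low4_strict.
have y0 u v p q r : reduced4 u v p q r -> u = 0 -> v = 0.
  by move=> [[[_ ->]|[u0 _]] _] // u1; rewrite u1 eqxx in u0.
rewrite /wall4; have [x0 | x0] := eqVneq x 0; have [x'0 | x'0] := eqVneq x' 0 => //.
- case: (low4_not_sim_third red' x'0 (a := a) (b := b) (c := c)); move: s.
  by rewrite x0 (y0 _ _ _ _ _ red x0).
- case: (low4_not_sim_third red x0 (a := a') (b := b') (c := c')); move: s'.
  by rewrite x'0 (y0 _ _ _ _ _ red' x'0).
have [c0 | c0] := eqVneq c 0; have [c'0 | c'0] := eqVneq c' 0 => //.
  case: (low4_not_sim_last red' x'0 c'0 (x := x) (y := y) (a := a) (b := b)).
  by rewrite c0 in s.
case: (low4_not_sim_last red x0 c0 (x := x') (y := y') (a := a') (b := b')).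
by rewrite c'0 in s'.
Qed.

(** * Walls of arbitrary matrices and the classification *)

Lemma sim_normal_form W (N : 'M[F]_4) W' N' : normal_form W N -> normal_form W' N' ->
  sim N N' -> W = W'.
Proof.
move=> nN nN' s.
have s' : sim N' N.
  by apply: sim_sym s => //; [exact: normal_form_strict nN | exact: normal_form_strict nN'].
have [[-> N0]|[x [y [a [b [c [E red ->]]]]]]] := normal_form_reduced4 nN;
have [[-> N'0]|[x' [y' [a' [b' [c' [E' red' ->]]]]]]] := normal_form_reduced4 nN'.
- by [].
- by case: (zero_not_sim_low4 red'); rewrite -E' -N0.
- by case: (zero_not_sim_low4 red); rewrite -E -N'0.
by apply: sim_wall4 red red' _; rewrite -E -E'.
Qed.

Lemma normal_form_one_ref W (N : 'M[F]_4) : normal_form W N -> one_ref N.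
Proof.
case/normal_form_reduced4 => [[_ ->]|[x [y [a [b [c [-> red _]]]]]]].
  by split; [rewrite -low4_0; exact: low4_strict | left].
exact: one_ref_low4.
Qed.

Lemma one_ref_reduces (S : 'M[F]_4) : one_ref S -> reduces (wall_ref S) S.
Proof.
case/one_ref_inv => [->|[x [y [a [b [c [-> red]]]]]]].
  by rewrite wall_zero; exact/normal_form_reduces/NormalZero.
rewrite wall_ref_low4 //; first exact: reduced4_reduces.
move=> /(sim_sym two_neq0) s; case: (zero_not_sim_low4 red); apply: s.
  exact: low4_strict.
by rewrite -low4_0; exact: low4_strict.
Qed.

(** Whichever 1-REF representative [xget] picks has a normal form similar to [N], hence the same
    wall. As [N] is itself such a representative, the default value never occurs. *)
Lemma wall_reduces (T : 'M[F]_4) W : strict_lower T -> reduces W T -> wall T = W.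
Proof.
move=> lT [N nN TN]; rewrite /wall.
case: xgetP => [S _ [rS TS]|/(_ N)[]]; last by split=> //; exact: normal_form_one_ref nN.
have [N' nN' SN'] := one_ref_reduces rS.
apply: (sim_normal_form nN' nN); apply: sim_trans TN.
apply: (sim_sym two_neq0 lT (normal_form_strict nN')).
exact: sim_trans TS SN'.
Qed.

Lemma sim_simclass (T S : 'M[F]_4) : strict_lower T -> strict_lower S -> sim T S ->
  simclass T = simclass S.
Proof.
move=> lT lS TS; apply/seteqP; split=> R [lR sR]; split=> //.
  exact: sim_trans (sim_sym two_neq0 lT lS TS) sR.
exact: sim_trans TS sR.
Qed.

Lemma TMbar_normal_form W : TMbar F 4 W = [set simclass N | N in normal_form W]%classic.
Proof.
apply/seteqP; split=> C [T].
  move=> [lT wT] <-; have [W' hW'] := reduces_strict two_neq0 lT.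
  have [N nN TN] := hW'; exists N; first by rewrite /= -wT (wall_reduces lT hW').
  by rewrite (sim_simclass lT (normal_form_strict nN) TN).
move=> nT <-; exists T => //; have lT := normal_form_strict nT.
by split=> //; exact: wall_reduces lT (normal_form_reduces nT).
Qed.

End Invariance.

Theorem proposition2p5 (F : fieldType) (hF : 2%N \notin [pchar F]) :
  [/\ TMbar F 4 [:: 0%N] = [set simclass (0 : 'M[F]_4)],
      TMbar F 4 [:: 4%N] = [set simclass (@matB F); simclass (@matB' F)],
      TMbar F 4 [:: 3%N; 4%N] = [set simclass (matC a) | a in [set: F]]
    & TMbar F 4 [:: 3%N] = [set simclass (matD u) | u in [set u : F | u != 0]]].
Proof.
have two_neq0 : 2%:R != 0 :> F by move: hF; rewrite inE.
split; rewrite TMbar_normal_form //; apply/seteqP; split=> X.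
- by case=> N nN <-; inversion nN.
- by move=> ->; exists 0 => //; exact: NormalZero.
- by case=> N nN <-; inversion nN; [left | right].
- case=> ->; first by exists matB => //; exact: NormalB.
  by exists matB' => //; exact: NormalB'.
- by case=> N nN <-; inversion nN; exists a.
- by case=> a _ <-; exists (matC a) => //; exact: NormalC.
- by case=> N nN <-; inversion nN; exists u.
by case=> u u0 <-; exists (matD u) => //; exact: NormalD.
Qed.
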